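(* Let $G$ be a graph on $n$ vertices given as a dynamic stream of edge updates (insertions and deletions, final edge multiplicities in $\{0,1\}$, stream length polynomial in $n$). There exists a streaming interactive proof for verifying the number of connected components of $G$ with $O(\log n)$ rounds of communication and cost $(\log^2 n, n\log n)$.
   Context: A streaming interactive proof (SIP) for a function $f$ of a data stream $\tau$: a randomized verifier $V$ reads $\tau$ once in a streaming fashion (as does the prover $P$); after the stream has passed, $V$ and $P$ exchange messages, after which $V$ outputs a value or $\perp$ (rejection). There must be a prover strategy causing $V$ to output $f(\tau)$ with probability at least $2/3$, and for every prover strategy $V$ must output a value in $\{f(\tau),\perp\}$ with probability at least $2/3$. Cost $(A,B)$ means verifier space $O(A)$ bits and total communication $O(B)$ bits. *)

(* Defs.v *)
From mathcomp Require Import all_boot all_order all_algebra.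
Set Implicit Arguments. Unset Strict Implicit. Unset Printing Implicit Defensive.
Import Order.TTheory GRing.Theory Num.Theory.

(* Streaming interactive proofs (SIP), information-theoretic model.    *)
(* The verifier's entire memory is an S-bit state (S.-tuple bool).      *)
(* Every step (start, each stream update, each message it sends, each  *)
(* bit of prover message it reads) uses fresh uniform random bits      *)
(* (an S.-tuple bool).  The prover is an arbitrary deterministic        *)
(* function of the whole stream and of the transcript so far.          *)

Record verifier (U : Type) (S : nat) := Verifier {
  v_rounds : nat;
  v_init   : S.-tuple bool -> S.-tuple bool;
  v_update : S.-tuple bool -> U -> S.-tuple bool -> S.-tuple bool;
  v_send   : nat -> S.-tuple bool -> S.-tuple bool -> S.-tuple bool * seq bool;
  v_recv   : S.-tuple bool -> bool -> S.-tuple bool -> S.-tuple bool;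
  v_out    : S.-tuple bool -> option nat                  (* None = reject *)
}.

Definition prover (U : Type) := seq U -> seq (seq bool) -> seq bool.

Section Run.
Variables (U : Type) (S : nat) (A : Type).
Variable comb : (S.-tuple bool -> A) -> A.   (* how fresh randomness is aggregated *)
Variable V : verifier U S.

Fixpoint run_stream (st : S.-tuple bool) (s : seq U) (k : S.-tuple bool -> A) : A :=
  match s with
  | [::] => k st
  | u :: s' => comb (fun r => run_stream (v_update V st u r) s' k)
  end.

Fixpoint run_read (st : S.-tuple bool) (w : seq bool) (k : S.-tuple bool -> A) : A :=
  match w with
  | [::] => k st
  | b :: w' => comb (fun r => run_read (v_recv V st b r) w' k)
  end.

Fixpoint run_rounds (P : prover U) (tau : seq U) (i fuel : nat)
    (st : S.-tuple bool) (tr : seq (seq bool))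
    (k : S.-tuple bool -> seq (seq bool) -> A) : A :=
  match fuel with
  | 0 => k st tr
  | fuel'.+1 =>
      comb (fun r =>
        let: (st1, m) := v_send V i st r in
        let w := P tau (rcons tr m) in
        run_read st1 w (fun st2 =>
          run_rounds P tau i.+1 fuel' st2 (rcons (rcons tr m) w) k))
  end.

Definition run (P : prover U) (tau : seq U)
    (k : S.-tuple bool -> seq (seq bool) -> A) : A :=
  comb (fun r => run_stream (v_init V r) tau
         (fun st => run_rounds P tau 0 (v_rounds V) st [::] k)).
End Run.

Definition avg (S : nat) (f : S.-tuple bool -> rat) : rat :=
  ((\sum_(r : S.-tuple bool) f r) / ((2 ^ S)%N)%:R)%R.

Definition prob_out (U : Type) (S : nat) (V : verifier U S) (P : prover U)
    (tau : seq U) (E : option nat -> bool) : rat :=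
  run (@avg S) V P tau (fun st _ => ((E (v_out V st)) : nat)%:R%R).

Definition always (U : Type) (S : nat) (V : verifier U S) (P : prover U)
    (tau : seq U) (Q : S.-tuple bool -> seq (seq bool) -> bool) : bool :=
  run (fun f : S.-tuple bool -> bool => [forall r, f r]) V P tau Q.

(* V is a SIP for f on the streams satisfying [valid], with at most
   [rho] rounds and total communication at most [C] bits (verifier space
   is S bits by construction). *)
Definition is_SIP (U : Type) (S : nat) (V : verifier U S)
    (valid : seq U -> bool) (f : seq U -> nat) (C rho : nat) : Prop :=
  v_rounds V <= rho /\
  (exists Ph : prover U, forall tau, valid tau ->
      (2%:R / 3%:R <= prob_out V Ph tau (fun o => o == Some (f tau)))%R /\
      always V Ph tau (fun _ tr => sumn (map size tr) <= C)) /\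
  (forall (P : prover U) tau, valid tau ->
      (2%:R / 3%:R <= prob_out V P tau (fun o => (o == Some (f tau)) || (o == None)))%R).

(* An update ((u,v),b) names the edge {u,v} with u < v; b = true is an  *)
(* insertion, b = false a deletion.                                    *)

Definition upd (n : nat) := ('I_n * 'I_n * bool)%type.

Definition mult (n : nat) (tau : seq (upd n)) (u v : 'I_n) : int :=
  ((count (fun x : upd n => (x.1 == (u, v)) && x.2) tau)%:Z
  - (count (fun x : upd n => (x.1 == (u, v)) && ~~ x.2) tau)%:Z)%R.

Definition valid_stream (n k : nat) (tau : seq (upd n)) : bool :=
  [&& size tau <= n ^ k,
      all (fun x : upd n => x.1.1 < x.1.2) tau &
      [forall u : 'I_n, forall v : 'I_n,
         (u < v) ==> ((mult tau u v == 0%R) || (mult tau u v == 1%R))]].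

Definition adj (n : nat) (tau : seq (upd n)) : rel 'I_n :=
  fun x y => ((x < y) && (mult tau x y == 1%R)) || ((y < x) && (mult tau y x == 1%R)).

Definition num_cc (n : nat) (tau : seq (upd n)) : nat := n_comp (adj tau) predT.

(* Main.v *)
Require Import Defs.
From mathcomp Require Import all_boot all_order all_algebra.
From mathcomp Require Import zify ring lra.
Set Implicit Arguments. Unset Strict Implicit. Unset Printing Implicit Defensive.
Import Order.TTheory GRing.Theory Num.Theory.

(* The prover sends, for every vertex i, a label l i, a parent p i, a depth d i
   and a number of children; the roots are the vertices with l i = i. If every
   non-root is joined in G to its parent, which has depth one less, and no edge
   joins different labels, then every component contains exactly one root.
   Depths are checked by one random evaluation of a polynomial identity between
   the multisets {(p i, d i)} and {(i, d i + 1)}. Over a prime field of size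
   n^O(1), the statement about G amounts to a single equation
   \sum_(u, v) W u v * M u v = #non-roots, with M the adjacency matrix and W a
   matrix determined by the labels and parents, which is verified by a two-round
   sum-check: the verifier keeps two secret points x, y and the streamed value
   of the bivariate polynomial of M at (x, y), and reveals only x. Its whole
   memory is O(1) field elements, all of them linear accumulators. *)

(** * A prime between two powers of 2, from central binomial coefficients *)

Lemma leq_central_bin x : 2 ^ x <= 'C(2 * x, x).
Proof.
elim: x => [|x IHx]; first by rewrite bin0.
rewrite (_ : 2 * x.+1 = (2 * x).+2); last by lia.
rewrite binS expnS mul2n -addnn leq_add //; apply: leq_trans IHx _.
  by rewrite binS leq_addl.
by case: x => [//|x]; rewrite [leqRHS]binS leq_addr.
Qed.

(** By Legendre's formula the exponent of [p] is a sum over [k] of the differences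
    [2x %/ p^k - 2 (x %/ p^k)]. Each is 0 or 1, and it is 0 once [p ^ k > 2 * x]. *)
Lemma pfactor_central_bin p x : prime p -> 0 < x ->
  p ^ logn p 'C(2 * x, x) <= 2 * x.
Proof.
move=> pr_p x_gt0; have p_gt1 := prime_gt1 pr_p.
apply: leq_trans (trunc_logP p_gt1 _); last by lia.
rewrite leq_exp2l //.
have [Cx_gt0 fx_gt0] : 0 < 'C(2 * x, x) /\ 0 < x`!.
  by rewrite bin_gt0 fact_gt0; split=> //; lia.
have := congr1 (logn p) (@bin_fact (2 * x) x ltac:(lia)).
rewrite (_ : 2 * x - x = x); last by lia.
rewrite !lognM ?muln_gt0 ?Cx_gt0 ?fx_gt0 // !logn_fact //.
(* The terms with [k > x] vanish because [p ^ k > k]. *)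
have -> : \sum_(1 <= k < x.+1) x %/ p ^ k = \sum_(1 <= k < (2 * x).+1) x %/ p ^ k.
  rewrite [RHS](@big_cat_nat _ _ _ x.+1) //=; last by lia.
  rewrite [X in _ + X]big_nat_cond [X in _ + X]big1 ?addn0 // => i /andP[/andP[xi _] _].
  rewrite divn_small //; apply: leq_trans xi _; exact/ltnW/ltn_expl.
suff : \sum_(1 <= k < (2 * x).+1) (2 * x) %/ p ^ k <=
       \sum_(1 <= k < (2 * x).+1) x %/ p ^ k + \sum_(1 <= k < (2 * x).+1) x %/ p ^ k
       + trunc_log p (2 * x) by lia.
apply: (@leq_trans (\sum_(1 <= k < (2 * x).+1)
   (x %/ p ^ k + x %/ p ^ k + (k <= trunc_log p (2 * x))))).
  apply: leq_sum => k _.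
  have q_gt0 : 0 < p ^ k by rewrite expn_gt0; lia.
  have [pk|pk] := leqP (p ^ k) (2 * x); last by rewrite divn_small.
  rewrite (trunc_log_max _ pk) // -ltnS ltn_divLR //.
  have := ltn_ceil x q_gt0; nia.
rewrite !big_split /= leq_add2l.
rewrite (eq_bigr (fun k => if k <= trunc_log p (2 * x) then 1 else 0)); last by move=> k _; case: leqP.
rewrite -big_mkcond -big_filter /= sum1_size; set s := filter _ _.
have : {subset s <= iota 1 (trunc_log p (2 * x))}.
  by move=> k; rewrite mem_filter mem_iota mem_index_iota; lia.
by move/uniq_leq_size => /(_ (filter_uniq _ (iota_uniq _ _))); rewrite size_iota.
Qed.

(* If no prime in the range existed, the central binomial coefficient at
   [4 ^ m] would be a product of at most [2 ^ m] prime powers, each at most [2 * 4 ^ m]. *)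
Lemma prime_between_exp2 m : 4 <= m ->
  exists p, [/\ prime p, 2 ^ m < p & p <= 2 ^ (2 * m).+1].
Proof.
move=> m_ge4; set x := 2 ^ (2 * m); set C := 'C(2 * x, x).
have x_gt0 : 0 < x by rewrite expn_gt0.
have C_gt0 : 0 < C by rewrite bin_gt0; lia.
have le2x p : prime p -> p %| C -> p <= 2 ^ (2 * m).+1.
  move=> pr_p pC; rewrite expnS -/x; apply: leq_trans (pfactor_central_bin pr_p x_gt0).
  by rewrite -{1}(expn1 p) leq_exp2l ?prime_gt1 // logn_gt0 mem_primes pr_p C_gt0.
have [/hasP[p]|/hasPn small] := boolP (has (fun p => 2 ^ m < p) (primes C)).
  by rewrite mem_primes => /and3P[pr_p _ pC] mp; exists p; split=> //; apply: le2x.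
exfalso.
have : C <= (2 * x) ^ (2 ^ m).
  rewrite [leqLHS](prod_prime_decomp C_gt0) prime_decompE big_map /=.
  apply: (@leq_trans ((2 * x) ^ size (primes C))).
    rewrite -sum1_size expn_sum big_seq [leqRHS]big_seq; apply: leq_prod => p.
    by rewrite mem_primes expn1 => /and3P[pr_p _ _]; apply: pfactor_central_bin.
  apply: leq_pexp2l; first by lia.
  rewrite -(size_iota 1 (2 ^ m)); apply: uniq_leq_size (primes_uniq _) _ => p pC.
  have := small p pC; rewrite mem_iota; move: pC; rewrite mem_primes => /andP[/prime_gt0]; lia.
(* Since [2 * x = 2 ^ (2 * m).+1], comparing exponents of 2 leaves [(2 * m).+1 < 2 ^ m]. *)
apply/negP; rewrite -ltnNge; apply: leq_trans (leq_central_bin x).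
rewrite -expnS -expnM ltn_exp2l // /x (_ : 2 ^ (2 * m) = 2 ^ m * 2 ^ m); last first.
  by rewrite -expnD addnn mul2n.
rewrite ltn_pmul2r ?expn_gt0 //.
elim: m m_ge4 {x C x_gt0 C_gt0 le2x small} => // m IH.
by rewrite leq_eqVlt => /orP[/eqP<-//|/IH]; rewrite [2 ^ m.+1]expnS; lia.
Qed.

(** * Averages over uniform bit strings *)

Section Average.
Local Open Scope ring_scope.

Lemma eq_avg S (f g : S.-tuple bool -> rat) : f =1 g -> avg f = avg g.
Proof. by move=> fg; congr (_ / _); apply: eq_bigr. Qed.

Lemma exp2_neq0 S : ((2 ^ S)%N)%:R != 0 :> rat.
Proof. by rewrite pnatr_eq0 expn_eq0. Qed.

Lemma avg_const S (a : rat) : avg (fun _ : S.-tuple bool => a) = a.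
Proof.
by rewrite /avg sumr_const card_tuple card_bool -[a *+ _]mulr_natr mulfK ?exp2_neq0.
Qed.

Lemma ler_avg S (f g : S.-tuple bool -> rat) :
  (forall r, f r <= g r) -> avg f <= avg g.
Proof.
move=> fg; rewrite /avg ler_pM2r; first by apply: ler_sum.
by rewrite invr_gt0 ltr0n expn_gt0.
Qed.

Lemma avgD S (f g : S.-tuple bool -> rat) :
  avg (fun r => f r + g r) = avg f + avg g.
Proof. by rewrite /avg big_split mulrDl. Qed.

Lemma avgBl S (a : rat) (f : S.-tuple bool -> rat) :
  avg (fun r => a - f r) = a - avg f.
Proof.
rewrite -[in RHS](avg_const S a) /avg -mulrBl; congr (_ / _).
by rewrite -sumrB.
Qed.

Lemma avg_indicator S (Q : pred (S.-tuple bool)) :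
  avg (fun r => (Q r : nat)%:R) = #|Q|%:R / ((2 ^ S)%N)%:R.
Proof.
congr (_ / _); rewrite -sum1_card natr_sum [RHS]big_mkcond /=.
by apply: eq_bigr => r _; rewrite unfold_in; case: (Q r).
Qed.

Lemma avg_cat a b (f : (a + b).-tuple bool -> rat) :
  avg f = avg (fun x : a.-tuple bool => avg (fun y : b.-tuple bool => f [tuple of x ++ y])).
Proof.
rewrite /avg -mulr_suml -mulrA -invfM -natrM mulnC -expnD; congr (_ / _).
rewrite pair_big /=.
have sz1 (t : (a + b).-tuple bool) : size (take a t) == a.
  by rewrite size_takel // size_tuple leq_addr.
have sz2 (t : (a + b).-tuple bool) : size (drop a t) == b.
  by rewrite size_drop size_tuple addKn.
rewrite (reindex (fun p : a.-tuple bool * b.-tuple bool => [tuple of p.1 ++ p.2])) //=.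
exists (fun t => (Tuple (sz1 t), Tuple (sz2 t))) => [[x y] _|t _].
  congr (_, _); apply: val_inj; first by rewrite /= take_size_cat ?size_tuple.
  by rewrite /= drop_size_cat ?size_tuple.
by apply: val_inj; rewrite /= cat_take_drop.
Qed.
End Average.

(** Lets a verifier be described on structured states of a finite type and still live in [S]
    bits. *)
Lemma bit_coding (T : finType) (x0 : T) S : #|T| <= 2 ^ S ->
  exists (enc : T -> S.-tuple bool) (dec : S.-tuple bool -> T), cancel enc dec.
Proof.
move=> leT; pose B := enum {: S.-tuple bool}.
have szB : size B = 2 ^ S by rewrite -cardE card_tuple card_bool.
exists (fun x => nth [tuple of nseq S false] B (enum_rank x)).
exists (fun t => nth x0 (enum T) (index t B)) => x.
rewrite index_uniq ?enum_uniq ?nth_enum_rank //.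
by rewrite szB; apply: leq_trans leT; apply: ltn_ord.
Qed.

(** * Two-round verifiers that accumulate a sum of contributions *)

Section LinearVerifier.
Variables (U : Type) (S : nat) (R A : finType) (Z : finZmodType) (b K : nat).
Hypothesis b_gt0 : 0 < b.
Variables (decA : seq bool -> A) (gu : R -> U -> Z) (gw : R -> nat -> A -> Z).
Variables (msg : R -> seq bool) (out : R -> Z -> option nat).
Variable seed : S.-tuple bool -> R.

Local Notation N := (2 * K * b).
(* seed, accumulator, number of bits read (saturating at [N.+1], which means
   rejection) and the last [b] bits read *)
Definition lv_state := (R * Z * 'I_N.+2 * b.-tuple bool)%type.

Variables (enc : lv_state -> S.-tuple bool) (dec : S.-tuple bool -> lv_state).
Hypothesis encK : cancel enc dec.

Definition lv_count (c : nat) : 'I_N.+2 := inord (minn c N.+1).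
Definition lv_init (r : R) : lv_state := (r, 0%R, lv_count 0, [tuple of nseq b false]).
Definition lv_update (s : lv_state) u : lv_state :=
  let: (r, z, c, t) := s in (r, (z + gu r u)%R, c, t).
(** Applied between the two prover messages: a first message of the wrong length moves the counter
    to the rejecting value [N.+1]. *)
Definition lv_check (s : lv_state) : lv_state :=
  let: (r, z, c, t) := s in (r, z, lv_count (if c == K * b :> nat then c : nat else N.+1), t).
(** When the bit count reaches a multiple of [b], the register [t'] holds a full word, whose index
    is [c %/ b]. *)
Definition lv_recv (s : lv_state) x : lv_state :=
  let: (r, z, c, t) := s in
  let t' := [tuple of behead (rcons t x)] in
  (r, if b %| c.+1 then (z + gw r (c %/ b) (decA t'))%R else z, lv_count c.+1, t').
Definition lv_out (s : lv_state) : option nat :=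
  let: (r, z, c, t) := s in if c == N :> nat then out r z else None.

(** All randomness comes from the initial seed, and the first message to the prover is empty. The
    prover thus commits to its first answer before [msg] is revealed. *)
Definition linear_verifier : verifier U S := Verifier 2
  (fun r => enc (lv_init (seed r)))
  (fun s u _ => enc (lv_update (dec s) u))
  (fun i s _ => if i is 0 then (s, [::])
                else (enc (lv_check (dec s)), msg (dec s).1.1.1))
  (fun s x _ => enc (lv_recv (dec s) x))
  (fun s => lv_out (dec s)).

Definition lv_msg0 (P : prover U) tau := P tau [:: [::]].
Definition lv_msg1 (P : prover U) tau r := P tau [:: [::]; lv_msg0 P tau; msg r].
Definition lv_transcript P tau r :=
  [:: [::]; lv_msg0 P tau; msg r; lv_msg1 P tau r].
Definition lv_final P tau r :=
  foldl lv_recv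
    (lv_check (foldl lv_recv (foldl lv_update (lv_init r) tau) (lv_msg0 P tau)))
    (lv_msg1 P tau r).

Lemma lv_recv_seed s w : (foldl lv_recv s w).1.1.1 = s.1.1.1.
Proof. by elim: w s => //= x w IH s; rewrite IH; case: s => [[[]]]. Qed.

Lemma lv_update_seed s tau : (foldl lv_update s tau).1.1.1 = s.1.1.1.
Proof. by elim: tau s => //= x w IH s; rewrite IH; case: s => [[[]]]. Qed.

(** The aggregator [comb] is abstract so as to cover both [avg] and the universal quantifier of
    [always]. After initialization every step ignores its fresh bits and therefore aggregates a
    constant. *)
Lemma run_linear_verifier B (comb : (S.-tuple bool -> B) -> B) P tau k :
    (forall f g, f =1 g -> comb f = comb g) -> (forall a, comb (fun _ => a) = a) ->
  run comb linear_verifier P tau k =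
  comb (fun rho => k (enc (lv_final P tau (seed rho))) (lv_transcript P tau (seed rho))).
Proof.
move=> comb_ext comb_const.
have combE f a : (forall r, f r = a) -> comb f = a.
  by move=> fa; rewrite (comb_ext f (fun _ => a)).
have streamE s k' : run_stream comb linear_verifier (enc s) tau k' =
    k' (enc (foldl lv_update s tau)).
  by elim: tau s => //= u tau' IH s; apply: (combE) => _; rewrite encK IH.
have readE s w k' : run_read comb linear_verifier (enc s) w k' =
    k' (enc (foldl lv_recv s w)).
  by elim: w s => //= x w IH s; apply: (combE) => _; rewrite encK IH.
apply: comb_ext => rho; rewrite streamE /=; apply: (combE) => _.
rewrite readE /=; apply: (combE) => _; rewrite encK readE /=.
by rewrite lv_recv_seed lv_update_seed.
Qed.

Lemma lv_countE c : lv_count c = minn c N.+1 :> nat.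
Proof. by rewrite inordK // ltnS geq_minr. Qed.

Lemma lv_recv_count s w :
  (foldl lv_recv s w).1.2 = minn (s.1.2 + size w) N.+1 :> nat.
Proof.
elim: w s => [|x w IH] [[[r z] c] t] /=; first by have := ltn_ord c; lia.
by rewrite IH /= lv_countE; lia.
Qed.

(** Partial words are allowed so that induction on the last bit goes through. After [b] bits the old
    register content [t] has been shifted out. *)
Lemma lv_recv_word (r : R) z (c : 'I_N.+2) t i y :
    c = i * b :> nat -> size y <= b -> i * b + b <= N ->
  let s := foldl lv_recv (r, z, c, t) y in
  s.2 = drop (size y) (t ++ y) :> seq bool /\
  s.1.1.2 = if size y == b then (z + gw r i (decA y))%R else z.
Proof.
move=> ci; elim/last_ind: y => [|y x IH] szy iN /=.
  by rewrite cats0 drop0 eq_sym (gtn_eqF b_gt0).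
rewrite size_rcons in szy *; rewrite foldl_rcons.
have [] := IH (ltnW szy) iN.
have := lv_recv_count (r, z, c, t) y.
have := lv_recv_seed (r, z, c, t) y.
case: (foldl _ _ _) => [[[r' z'] c'] t'] /= -> c'E t'E ->.
have {}c'E : c' = i * b + size y :> nat by rewrite c'E ci; lia.
have szt := size_tuple t.
have regE : behead (rcons t' x) = drop (size y).+1 (t ++ rcons y x).
  by rewrite t'E -drop1 -drop_rcons ?size_cat ?leq_addl // drop_drop add1n rcons_cat.
split=> //; rewrite (ltn_eqF szy) c'E -addnS dvdn_addr ?dvdn_mull //.
have -> : (b %| (size y).+1) = ((size y).+1 == b).
  apply/idP/eqP => [|->//] /dvdn_leq; lia.
case: eqP => // szE; rewrite divnMDl // divn_small // addn0 regE szE.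
by rewrite drop_size_cat.
Qed.

Lemma lv_recv_words (r : R) z (c : 'I_N.+2) t i ws :
    all (fun y => size y == b) ws -> c = i * b :> nat -> (i + size ws) * b <= N ->
  (foldl lv_recv (r, z, c, t) (flatten ws)).1.1.2 =
  (z + \sum_(j < size ws) gw r (i + j) (decA (nth [::] ws j)))%R.
Proof.
elim: ws i z c t => [|y ws IH] i z c t /=; first by rewrite big_ord0 addr0.
case/andP=> /eqP szy szws ci iN; rewrite foldl_cat.
have := @lv_recv_word r z c t i y ci; rewrite szy leqnn eqxx => /(_ isT) /=.
case; first by lia.
have := lv_recv_count (r, z, c, t) y.
have := lv_recv_seed (r, z, c, t) y.
case: (foldl _ _ _) => [[[r' z'] c'] t'] /= -> c'E _ ->.
have {}c'E : c' = i.+1 * b :> nat by rewrite c'E ci szy; lia.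
rewrite (IH i.+1) //; last by lia.
rewrite big_ord_recl /= addn0 addrA; congr (_ + _)%R.
by apply: eq_bigr => j _; rewrite /bump /= add1n addnS addSn.
Qed.

Definition lv_words w : seq A := [seq decA y | y <- reshape (nseq K b) w].

Lemma lv_words_spec (w : seq bool) : size w = K * b ->
  [/\ all (fun y => size y == b) (reshape (nseq K b) w),
      size (reshape (nseq K b) w) = K & flatten (reshape (nseq K b) w) = w].
Proof.
move=> szw; have sumK : sumn (nseq K b) = size w by rewrite sumn_nseq szw mulnC.
have shK : shape (reshape (nseq K b) w) = nseq K b by rewrite reshapeKl ?sumK.
split; last by rewrite reshapeKr ?sumK.
  have -> (ws : seq (seq bool)) : all (fun y => size y == b) ws = all (pred1 b) (shape ws).
    by rewrite all_map.
  by rewrite shK; apply/all_pred1P; rewrite size_nseq.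
by rewrite -(size_map size) -/(shape _) shK size_nseq.
Qed.

Definition lv_answer (a0 : A) (P : prover U) tau r : option nat :=
  if (size (lv_msg0 P tau) == K * b) && (size (lv_msg1 P tau r) == K * b) then
    out r (\sum_(u <- tau) gu r u
      + (\sum_(j < K) gw r j (nth a0 (lv_words (lv_msg0 P tau)) j)
      + \sum_(j < K) gw r (K + j) (nth a0 (lv_words (lv_msg1 P tau r)) j)))%R
  else None.

Lemma lv_out_final a0 P tau r : lv_out (lv_final P tau r) = lv_answer a0 P tau r.
Proof.
rewrite /lv_final /lv_answer; set w0 := lv_msg0 P tau; set w1 := lv_msg1 P tau r.
have updE z c t : foldl lv_update (r, z, c, t) tau = (r, z + \sum_(u <- tau) gu r u, c, t)%R.
  elim: tau z {w0 w1} => [|u tau' IH] z /=; first by rewrite big_nil addr0.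
  by rewrite IH big_cons addrA.
rewrite [foldl lv_update _ _]updE add0r {updE}.
set s0 := (r, _, _, _); set s1 := foldl _ s0 _.
have c1 : s1.1.2 = minn (size w0) N.+1 :> nat by rewrite lv_recv_count /= lv_countE; lia.
have r1 : s1.1.1.1 = r by rewrite lv_recv_seed.
set s2 := lv_check s1; set s3 := foldl _ s2 _.
have c3 : s3.1.2 = minn (s2.1.2 + size w1) N.+1 :> nat by rewrite lv_recv_count.
have c2 : s2.1.2 = (if size w0 == K * b then K * b else N.+1) :> nat.
  rewrite /s2; case: s1 c1 r1 {s2 s3 c3} => [[[r' z'] c'] t'] /= -> _.
  have -> : (minn (size w0) N.+1 == K * b) = (size w0 == K * b).
    by apply/eqP/eqP; rewrite -mulnA; lia.
  by rewrite lv_countE -mulnA; case: eqP => [->|_]; lia.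
have r3 : s3.1.1.1 = r.
  by rewrite lv_recv_seed /s2; case: s1 r1 {c1 c2 s2 s3 c3} => [[[? ?] ?] ?].
(* A first message of the wrong length leaves the counter at [N.+1], where it stays, so the final
   test against [N] fails. *)
have [/eqP sz0|sz0] /= := boolP (size w0 == K * b); last first.
  rewrite (negPf sz0) in c2; rewrite /lv_out; case: s3 c3 r3 => [[[? ?] c'] ?] /= c'E _.
  by rewrite ifF //; apply/eqP; lia.
rewrite sz0 eqxx in c2; have [/eqP sz1|sz1] := boolP (size w1 == K * b); last first.
  rewrite /lv_out; case: s3 c3 r3 => [[[? ?] c'] ?] /= c'E _.
  by rewrite ifF //; apply/eqP; move/eqP: sz1; nia.
have z3 : s3.1.1.2 = (\sum_(u <- tau) gu r u
      + (\sum_(j < K) gw r j (nth a0 (lv_words w0) j)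
      + \sum_(j < K) gw r (K + j) (nth a0 (lv_words w1) j)))%R.
  have [al0 szr0 fl0] := lv_words_spec sz0; have [al1 szr1 fl1] := lv_words_spec sz1.
  have : s1.1.1.2 = (\sum_(u <- tau) gu r u + \sum_(j < K) gw r j (nth a0 (lv_words w0) j))%R.
    rewrite /s1 -{1}fl0 (@lv_recv_words _ _ _ _ 0) ?szr0 ?lv_countE //; last by lia.
    congr (_ + _)%R; apply: eq_bigr => j _.
    by rewrite add0n (nth_map [::]) // szr0.
  move: c2; rewrite /s3 /s2; case: s1 c1 r1 {s2 s3 c3 r3} => [[[r' z'] c'] t'] /= _ -> c2 ->.
  rewrite -{1}fl1 (@lv_recv_words _ _ _ _ K) ?szr1 //; last by lia.
  rewrite addrA; congr (_ + _)%R; apply: eq_bigr => j _.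
  by rewrite (nth_map [::]) // szr1.
case: s3 c3 r3 z3 => [[[r' z'] c'] t'] /= c3 -> ->.
by rewrite c3 c2 sz1 ifT //; apply/eqP; lia.
Qed.

Lemma prob_linear_verifier a0 P tau (E : option nat -> bool) :
  prob_out linear_verifier P tau E =
  avg (fun rho => (E (lv_answer a0 P tau (seed rho)) : nat)%:R%R).
Proof.
rewrite /prob_out run_linear_verifier; last exact: avg_const; last exact: eq_avg.
by apply: eq_avg => rho /=; rewrite encK -lv_out_final.
Qed.

Lemma always_linear_verifier P tau (Q : S.-tuple bool -> seq (seq bool) -> bool) :
    (forall s r, Q s (lv_transcript P tau r)) ->
  always linear_verifier P tau Q.
Proof.
move=> HQ; rewrite /always run_linear_verifier; first by apply/forallP => r.
  by move=> f g fg; apply: eq_forallb.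
by move=> a; apply/forallP/idP => [/(_ [tuple of nseq S false])|].
Qed.
End LinearVerifier.

(** * The two-round sum-check *)

Section SumCheck.
Local Open Scope ring_scope.
Variables (K : fieldType) (n : nat).
Implicit Types (f g : 'I_n -> K) (M W : 'I_n -> 'I_n -> K).

(* The inner product of [f] and [g] is the coefficient of degree [n.-1]. *)
Definition dot_poly f g : {poly K} :=
  (\sum_u f u *: 'X^u) * (\sum_v g v *: 'X^(n.-1 - v)).

Lemma coef_dot_poly f g : (dot_poly f g)`_n.-1 = \sum_u f u * g u.
Proof.
rewrite /dot_poly mulr_suml coef_sum; apply: eq_bigr => u _.
rewrite mulr_sumr coef_sum (bigD1 u) //= big1 => [|v neq_vu].
  rewrite addr0 -scalerAl -scalerAr -exprD !coefZ coefXn subnKC ?eqxx ?mulr1 //.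
  by have := ltn_ord u; lia.
rewrite -scalerAl -scalerAr -exprD !coefZ coefXn.
case: eqP => [E|_]; last by rewrite !mulr0.
case/eqP: neq_vu; apply: val_inj => /=.
by have := ltn_ord u; have := ltn_ord v; lia.
Qed.

Lemma horner_dot_poly f g x :
  (dot_poly f g).[x] = (\sum_u f u * x ^+ u) * (\sum_v g v * x ^+ (n.-1 - v)).
Proof.
rewrite /dot_poly hornerM !horner_sum.
by congr (_ * _); apply: eq_bigr => u _; rewrite hornerZ hornerXn.
Qed.

Lemma size_dot_poly f g : (size (dot_poly f g) <= 2 * n)%N.
Proof.
apply: leq_trans (size_polyMleq _ _) _.
have sz (h : 'I_n -> K) (e : 'I_n -> nat) : (forall u, e u < n)%N ->
    (size (\sum_u h u *: 'X^(e u))%R <= n)%N.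
  move=> en; apply: leq_trans (size_sum _ _ _) _; apply/bigmax_leqP => u _.
  by apply: leq_trans (size_scale_leq _ _) _; rewrite size_polyXn.
have := sz f (fun u => u) (fun u => ltn_ord u).
have /sz : forall v : 'I_n, (n.-1 - v < n)%N by move=> v; have := ltn_ord v; lia.
move/(_ g); lia.
Qed.

(* First and second prover polynomial of the sum-check protocol for
   [\sum_u \sum_v W u v * M u v]. *)
Definition sumcheck1 M W : {poly K} := \sum_v dot_poly (W^~ v) (M^~ v).
Definition sumcheck2 M W x : {poly K} :=
  dot_poly (fun v => \sum_u W u v * x ^+ u) (fun v => \sum_u M u v * x ^+ (n.-1 - u)).

Lemma coef_sumcheck1 M W : (sumcheck1 M W)`_n.-1 = \sum_u \sum_v W u v * M u v.
Proof.
rewrite coef_sum exchange_big /=; apply: eq_bigr => v _.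
by rewrite coef_dot_poly.
Qed.

(** The link between the rounds: the value of the first polynomial at [x] is again an inner product,
    to which the second round applies. *)
Lemma coef_sumcheck2 M W x : (sumcheck2 M W x)`_n.-1 = (sumcheck1 M W).[x].
Proof.
rewrite coef_dot_poly horner_sum; apply: eq_bigr => v _.
by rewrite horner_dot_poly.
Qed.

(** Separates the final check into a factor depending on the certificate alone and one depending on
    the stream alone, so each can be accumulated in its own phase. *)
Lemma horner_sumcheck2 M W x y : (sumcheck2 M W x).[y] =
  (\sum_u \sum_v W u v * x ^+ u * y ^+ v) *
  (\sum_u \sum_v M u v * x ^+ (n.-1 - u) * y ^+ (n.-1 - v)).
Proof.
rewrite horner_dot_poly; congr (_ * _); rewrite [RHS]exchange_big /=;
  by apply: eq_bigr => v _; rewrite mulr_suml.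
Qed.

Lemma size_sumcheck1 M W : (size (sumcheck1 M W) <= 2 * n)%N.
Proof.
apply: leq_trans (size_sum _ _ _) _; apply/bigmax_leqP => v _.
exact: size_dot_poly.
Qed.

Variables (m : nat) (phi : m.-tuple bool -> K).
Hypothesis phi_inj : injective phi.

Lemma avg_root (q : {poly K}) : q != 0 ->
  avg (fun x => (root q (phi x) : nat)%:R) <= (size q)%:R / ((2 ^ m)%N)%:R.
Proof.
move=> q_neq0; rewrite avg_indicator ler_pM2r ?invr_gt0 ?ltr0n ?expn_gt0 //.
rewrite ler_nat; set Q := (X in #|X|).
rewrite -(size_image phi Q); apply/ltnW/max_poly_roots => //; last by rewrite map_inj_uniq ?enum_uniq.
by apply/allP => _ /imageP[x xQ ->].
Qed.

(** Either the wrong [p1] agrees with the honest polynomial at the first point, or a [p2] passing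
    the link test differs from the honest one and must agree with it at the second point. Each event
    has probability at most [2n / 2^m]; [p2] may depend on the first point but not on the second. *)
Lemma avg_sumcheck M W (p1 : {poly K}) (p2 : K -> {poly K}) :
    p1 != sumcheck1 M W -> (size p1 <= 2 * n)%N -> (forall x, size (p2 x) <= 2 * n)%N ->
  avg (fun x => avg (fun y =>
    (((p2 (phi x))`_n.-1 == p1.[phi x])
     && ((p2 (phi x)).[phi y] == (sumcheck2 M W (phi x)).[phi y]) : nat)%:R))
  <= (4 * n)%:R / ((2 ^ m)%N)%:R.
Proof.
move=> neq1 sz1 sz2; have m_gt0 : 0 < ((2 ^ m)%N)%:R :> rat by rewrite ltr0n expn_gt0.
have -> : (4 * n)%:R / ((2 ^ m)%N)%:R =
    (2 * n)%:R / ((2 ^ m)%N)%:R + (2 * n)%:R / ((2 ^ m)%N)%:R :> rat.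
  by rewrite -mulrDl -natrD -mulnDl.
have szB (p q : {poly K}) : (size p <= 2 * n)%N -> (size q <= 2 * n)%N ->
    (size (p - q))%:R / ((2 ^ m)%N)%:R <= (2 * n)%:R / ((2 ^ m)%N)%:R :> rat.
  move=> szp szq; rewrite ler_pM2r ?invr_gt0 // ler_nat.
  by apply: leq_trans (size_polyD _ _) _; rewrite size_polyN geq_max szp.
apply: le_trans (_ : avg (fun x => (root (p1 - sumcheck1 M W) (phi x) : nat)%:R
   + (2 * n)%:R / ((2 ^ m)%N)%:R) <= _); last first.
  rewrite avgD avg_const lerD2r; apply: le_trans (avg_root _) _; first by rewrite subr_eq0.
  exact: szB (size_sumcheck1 _ _).
apply: ler_avg => x; rewrite rootE hornerD hornerN subr_eq0.
have [_|neqx] /= := eqVneq p1.[phi x] (sumcheck1 M W).[phi x].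
  rewrite -[leLHS]addr0 lerD //; last by rewrite divr_ge0 // ltW.
  rewrite -[leRHS](avg_const m 1); apply: ler_avg => y.
  by case: (_ && _).
rewrite add0r; have [eqc|_] := eqVneq _ p1.[phi x]; last first.
  by rewrite avg_const divr_ge0 // ltW.
have neq2 : p2 (phi x) - sumcheck2 M W (phi x) != 0.
  by rewrite subr_eq0; apply: contraNneq neqx => E; rewrite -eqc E coef_sumcheck2.
apply: le_trans (_ : _ <= (size (p2 (phi x) - sumcheck2 M W (phi x)))%:R / _) _; last first.
  exact: szB (size_dot_poly _ _).
apply: le_trans (avg_root neq2); apply: ler_avg => y.
by rewrite rootE hornerD hornerN subr_eq0.
Qed.
End SumCheck.

(** * Spanning forest certificates as algebraic identities *)

Section Certificate.
Local Open Scope ring_scope.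
Variables (K : fieldType) (n : nat).
Variables (l p d : 'I_n -> 'I_n) (ch : 'I_n -> nat).
Hypothesis natK : forall a b : nat, (a <= n + n ^ 4)%N -> (b <= n + n ^ 4)%N ->
  a%:R = b%:R :> K -> a = b.

Definition depth_poly : {poly K} :=
  \sum_(i | l i != i) 'X^(p i * n.+1 + d i)
  - \sum_i (ch i)%:R *: 'X^(i * n.+1 + (d i).+1).

(** The monomial of [i] in the first sum can only be cancelled by a monomial of the second with the
    same exponent, and uniqueness of radix digits makes that the one of [p i]. The values of [ch] do
    not matter for this. *)
Lemma depth_poly_eq0 i : depth_poly = 0 -> l i != i -> (d (p i)).+1 = d i.
Proof.
move=> /eqP; rewrite subr_eq0 => /eqP E li.
have := congr1 (fun q : {poly K} => q`_(p i * n.+1 + d i)) E; rewrite !coef_sum /=.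
have radix (a b : nat) (x y : 'I_n) : (a <= n)%N -> (b <= n)%N ->
    (x * n.+1 + a = y * n.+1 + b)%N -> x = y /\ a = b.
  move=> an bn xy; have xyE : x = y :> nat.
    by have := congr1 (divn^~ n.+1) xy; rewrite !divnMDl // !divn_small ?addn0.
  by split; [exact: val_inj | move: xy; rewrite xyE; lia].
have [/existsP[j /eqP /radix[]]|/existsPn none] :=
    boolP [exists j : 'I_n, (p i * n.+1 + d i == j * n.+1 + (d j).+1)%N].
- by have := ltn_ord (d i); lia.
- exact: ltn_ord.
- by move=> ->.
rewrite [X in _ = X]big1 => [|j _]; last first.
  by rewrite coefZ coefXn (negPf (none j)) mulr0.
under eq_bigr do rewrite coefXn.
rewrite -natr_sum -[RHS]/(0%:R) (bigD1 i) //= eqxx => E0.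
(* The coefficient counts [i] and fewer than [n] others, so it is nonzero in [K] by [natK]. *)
suff bnd : (1 + \sum_(j | (l j != j) && (j != i))
     (p i * n.+1 + d i == p j * n.+1 + d j) <= n)%N.
  by have := natK (leq_trans bnd (leq_addr _ _)) (leq0n _) E0.
apply: leq_trans (_ : \sum_(j : 'I_n) 1 <= n)%N; last by rewrite sum1_card card_ord.
rewrite [leqRHS](bigD1 i) //= leq_add2l big_mkcondl /=.
by apply: leq_sum => j _; case: (_ != _) => //; exact: leq_b1.
Qed.

Lemma depth_poly_correct :
    (forall i, l i != i -> (d (p i)).+1 = d i) ->
    (forall i, ch i = #|[pred j | (l j != j) && (p j == i)]|) ->
  depth_poly = 0.
Proof.
move=> dE chE; apply/eqP; rewrite subr_eq0; apply/eqP.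
rewrite (partition_big p predT) //=; apply: eq_bigr => i _.
rewrite chE -sum1_card natr_sum scaler_suml; apply: eq_bigr => j /andP[lj /eqP <-].
by rewrite scale1r dE.
Qed.

Lemma size_depth_poly : (size depth_poly <= n * n.+1)%N.
Proof.
have bnd (x a : nat) : (x < n)%N -> (a <= n)%N -> (x * n.+1 + a < n * n.+1)%N.
  by move=> xn an; apply: leq_trans (_ : x.+1 * n.+1 <= _)%N; rewrite ?leq_mul2r ?xn // mulSn; lia.
apply: leq_trans (size_polyD _ _) _; rewrite size_polyN geq_max.
apply/andP; split; apply: leq_trans (size_sum _ _ _) _; apply/bigmax_leqP => i _.
  by rewrite size_polyXn bnd // ltnW.
by apply: leq_trans (size_scale_leq _ _) _; rewrite size_polyXn bnd.
Qed.

Definition lo (i j : 'I_n) := if (i < j)%N then i else j.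
Definition hi (i j : 'I_n) := if (i < j)%N then j else i.

(* Sum-check weights: for a 0/1 matrix [M], [\sum_u \sum_v W u v * M u v]
   counts the non-roots whose parent edge is present and subtracts a positive
   amount for every edge joining different labels, so it is at most the number
   of non-roots, with equality exactly for correct certificates. *)
Definition cert_weight (u v : 'I_n) : K :=
  (\sum_(i | l i != i) ((lo i (p i) == u) && (hi i (p i) == v) : nat)%:R)
  - ((l u)%:R - (l v)%:R) ^+ 2.

Variable M : 'I_n -> 'I_n -> bool.

(** Presents the sum as a difference of two natural numbers, ready for [natK]. The sum of the two
    truncated subtractions is the absolute difference of the labels. *)
Lemma sum_cert_weight :
  \sum_u \sum_v cert_weight u v * (M u v : nat)%:R =
  (\sum_(i | l i != i) (M (lo i (p i)) (hi i (p i)) : nat))%:R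
  - (\sum_u \sum_v (M u v * ((l u - l v) + (l v - l u)) ^ 2))%N%:R.
Proof.
transitivity (\sum_u \sum_v
    (\sum_(i | l i != i) ((lo i (p i) == u) && (hi i (p i) == v) : nat)%:R * (M u v : nat)%:R)
  - \sum_u \sum_v ((l u)%:R - (l v)%:R) ^+ 2 * (M u v : nat)%:R : K).
  rewrite -sumrB; apply: eq_bigr => u _; rewrite -sumrB; apply: eq_bigr => v _.
  by rewrite -mulr_suml -mulrBl.
congr (_ - _); last first.
  rewrite natr_sum; apply: eq_bigr => u _; rewrite natr_sum; apply: eq_bigr => v _.
  rewrite natrM natrX mulrC; congr (_ * _).
  have [le_uv|/ltnW le_vu] := leqP (l u) (l v).
    by rewrite (eqP le_uv) add0n natrB // -sqrrN opprB.
  by rewrite (eqP le_vu) addn0 natrB.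
transitivity (\sum_(i | l i != i) \sum_u \sum_v
    ((lo i (p i) == u) && (hi i (p i) == v) : nat)%:R * (M u v : nat)%:R : K).
  by rewrite [RHS]exchange_big; apply: eq_bigr => u _; rewrite exchange_big.
rewrite natr_sum; apply: eq_bigr => i _ /=.
rewrite (bigD1 (lo i (p i))) //= (bigD1 (hi i (p i))) //= !eqxx mul1r.
rewrite big1 => [|v /negPf nv]; last by rewrite eq_sym nv mul0r.
rewrite big1 ?addr0 // => u /negPf nu; apply: big1 => v _.
by rewrite eq_sym nu mul0r.
Qed.

Lemma cert_weight_sound :
    \sum_u \sum_v cert_weight u v * (M u v : nat)%:R = #|[pred i | l i != i]|%:R ->
  (forall i, l i != i -> M (lo i (p i)) (hi i (p i))) /\
  (forall u v, M u v -> l u = l v).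
Proof.
rewrite sum_cert_weight; set s := (\sum_(i | _) _)%N; set x := (\sum_u _)%N.
(* Over the naturals the equation becomes [s = q + x]; with [s <= q] it forces [x = 0] and
   [s = q]. *)
set q := #|_| => /eqP; rewrite subr_eq -natrD => /eqP/natK.
have s_le : (s <= q)%N.
  by rewrite /q -sum1_card; apply: leq_sum => i _; apply: leq_b1.
have q_le : (q <= n)%N by rewrite -[leqRHS]card_ord max_card.
(* There are [n ^ 2] pairs, each contributing at most [n ^ 2]; hence the range [n + n ^ 4] in
   [natK]. *)
have x_le : (x <= n ^ 4)%N.
  apply: leq_trans (_ : \sum_(u < n) \sum_(v < n) n ^ 2 <= _)%N.
    apply: leq_sum => u _; apply: leq_sum => v _.
    case: (M u v); rewrite ?mul0n // mul1n leq_sqr.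
    by have := ltn_ord (l u); have := ltn_ord (l v); lia.
  by rewrite !sum_nat_const card_ord -!expnS.
move=> /(_ ltac:(lia) ltac:(lia)) sE.
have x0 : x = 0%N by lia.
have sq : s = q by lia.
split=> [i li|u v Muv].
  case Mi: (M _ _) => //; suff : (s < q)%N by rewrite sq ltnn.
  rewrite /s /q -sum1_card (bigD1 i) //= [ltnRHS](bigD1 i) //= Mi add0n add1n ltnS.
  by apply: leq_sum => j _; apply: leq_b1.
move/eqP: x0; rewrite sum_nat_eq0 => /forallP/(_ u); rewrite sum_nat_eq0 => /forallP/(_ v).
by rewrite Muv mul1n expn_eq0 /= andbT => E; apply: val_inj => /=; lia.
Qed.

Lemma cert_weight_correct :
    (forall i, l i != i -> M (lo i (p i)) (hi i (p i))) ->
    (forall u v, M u v -> l u = l v) ->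
  \sum_u \sum_v cert_weight u v * (M u v : nat)%:R = #|[pred i | l i != i]|%:R.
Proof.
move=> forest cross; rewrite sum_cert_weight.
have -> : (\sum_u \sum_v (M u v * ((l u - l v) + (l v - l u)) ^ 2))%N = 0%N.
  apply: big1 => u _; apply: big1 => v _.
  by case: (M u v) (cross u v) => // -> //; rewrite subnn.
by rewrite subr0 -sum1_card; congr _%:R; apply: eq_bigr => i /forest ->.
Qed.

(** Expanding the square of the label difference turns the double sum into products of sums over one
    vertex, each computable while the certificate is read. *)
Lemma horner_cert_weight x y :
  \sum_u \sum_v cert_weight u v * x ^+ u * y ^+ v =
  (\sum_i (l i != i)%:R * (x ^+ lo i (p i) * y ^+ hi i (p i)))
  - ((\sum_i (l i)%:R ^+ 2 * x ^+ i) * (\sum_(i < n) y ^+ i)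
     + (\sum_(i < n) x ^+ i) * (\sum_i (l i)%:R ^+ 2 * y ^+ i)
     - 2 * ((\sum_i (l i)%:R * x ^+ i) * (\sum_i (l i)%:R * y ^+ i))).
Proof.
have -> : \sum_u \sum_v cert_weight u v * x ^+ u * y ^+ v =
  \sum_(u < n) \sum_(v < n) (\sum_(i | l i != i)
      ((lo i (p i) == u) && (hi i (p i) == v))%:R * (x ^+ u * y ^+ v))
  - \sum_(u < n) \sum_(v < n) ((l u)%:R ^+ 2 * x ^+ u * y ^+ v + x ^+ u * ((l v)%:R ^+ 2 * y ^+ v)
     - 2 * ((l u)%:R * x ^+ u * ((l v)%:R * y ^+ v))).
  rewrite -sumrB; apply: eq_bigr => u _; rewrite -sumrB; apply: eq_bigr => v _.
  by rewrite -mulr_suml /cert_weight; ring.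
congr (_ - _).
  transitivity (\sum_(i | l i != i) \sum_(u < n) \sum_(v < n)
      ((lo i (p i) == u) && (hi i (p i) == v))%:R * (x ^+ u * y ^+ v)).
    by rewrite [RHS]exchange_big; apply: eq_bigr => u _; rewrite exchange_big.
  rewrite [LHS]big_mkcond; apply: eq_bigr => i _ /=.
  case: (l i != i); last by rewrite mul0r.
  rewrite (bigD1 (lo i (p i))) //= (bigD1 (hi i (p i))) //= !eqxx.
  rewrite big1 => [|v /negPf nv]; last by rewrite eq_sym nv mul0r.
  rewrite big1 ?addr0 // => u /negPf nu; apply: big1 => v _.
  by rewrite eq_sym nu mul0r.
rewrite !mulr_suml mulr_sumr -big_split -sumrB /=; apply: eq_bigr => u _.
rewrite sumrB big_split /=; congr (_ + _ - _); first by rewrite mulr_sumr.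
  by rewrite mulr_sumr.
by rewrite mulr_sumr mulr_sumr.
Qed.
End Certificate.

(** * Counting components by rooted forests *)

Section Components.
Variables (T : finType) (e : rel T).
Hypothesis e_sym : symmetric e.

Let e_csym : connect_sym e := sym_connect_sym e_sym.

(** Descending along [p] decreases [d], so every vertex reaches some [y] with [l y = y]. Since [l]
    is constant on components, two such vertices in one component coincide. *)
Lemma n_comp_certificate (l p : T -> T) (d : T -> nat) :
    (forall x y, e x y -> l x = l y) ->
    (forall x, l x != x -> e x (p x)) ->
    (forall x, l x != x -> (d (p x)).+1 = d x) ->
  n_comp e predT = #|[pred x | l x == x]|.
Proof.
move=> l_edge p_edge d_dec.
have l_conn x y : connect e x y -> l x = l y.
  case/connectP=> q; elim: q x => [|z q IH] x /=; first by move=> _ ->.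
  by case/andP=> /l_edge -> /IH; apply.
have l_root x : exists2 y, connect e x y & l y == y.
  elim: (d x) {-2}x (leqnn (d x)) => [|k IH] y yk.
    by exists y => //; apply: contraLR yk => /d_dec <-.
  have [ly|ly] := boolP (l y == y); first by exists y.
  have [|z pz lz] := IH (p y); first by rewrite -ltnS d_dec.
  by exists z => //; apply: connect_trans (connect1 (p_edge _ ly)) pz.
rewrite -(@card_in_image _ _ (fingraph.root e)) => [|x y].
  apply: eq_card => x; rewrite !inE andbT; apply/eqP/imageP => [rx|[y _ ->]].
    have [y xy ly] := l_root x; exists y => //.
    by rewrite -{1}rx; apply/fingraph.rootP.
  exact: fingraph.root_root.
rewrite !inE => /eqP lx /eqP ly /fingraph.rootP => /(_ e_csym) /l_conn.
by rewrite lx ly.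
Qed.

(** Breadth-first search: [d] is the distance to the canonical root of the component, and [p] picks
    a neighbour one step closer. *)
Lemma bfs_forest : exists (p : T -> T) (d : T -> nat),
  [/\ forall x, d x < #|T|, forall x, fingraph.root e x != x -> e x (p x) &
      forall x, fingraph.root e x != x -> (d (p x)).+1 = d x].
Proof.
pose P x k := [exists t : k.-tuple T, path e x t && (last x t == fingraph.root e x)].
have exP x : exists k, P x k.
  have /connectP[q eq lq] := fingraph.connect_root e x.
  exists (size q); apply/existsP; exists (in_tuple q).
  by rewrite eq /= -lq.
pose d x := ex_minn (exP x).
have d_edge x y : e x y -> d x <= (d y).+1.
  move=> xy; rewrite /d; case: ex_minnP => k _ kmin; case: ex_minnP => j /existsP[t Pt] _.
  apply: kmin; apply/existsP; exists [tuple of y :: t] => /=.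
  by rewrite xy (fingraph.rootP e_csym (connect1 xy)).
have next x : fingraph.root e x != x -> exists y, e x y && ((d y).+1 == d x).
  move=> rx; have := erefl (d x); rewrite {1}/d; case: ex_minnP => k /existsP[t].
  case/andP; case: k t => [|k] t; first by rewrite tuple0 /= => _ /eqP xr; rewrite -xr eqxx in rx.
  case/tupleP: t => y t /= /andP[xy yt] lt _ dx; exists y; rewrite xy /= eqn_leq d_edge //.
  rewrite -dx ltnS andbT /d; case: ex_minnP => j _; apply; apply/existsP; exists t.
  by rewrite yt /= (eqP lt) (fingraph.rootP e_csym (connect1 xy)).
exists (fun x => odflt x [pick y | e x y && ((d y).+1 == d x)]), d.
split=> [x|x /next[y Py]|x /next[y Py]]; first last.
- by case: pickP => [z /andP[_ /eqP]|/(_ y)] //=; rewrite Py.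
- by case: pickP => [z /andP[]|/(_ y)] //=; rewrite Py.
rewrite /d; case: ex_minnP => k _ kmin.
have /connectP[q eq lq] := fingraph.connect_root e x.
(* A duplicate-free path has fewer than [#|T|] edges, which lets depths be sent as vertices. *)
case/shortenP: eq lq => q' eq' uq' _ lq'.
apply: leq_trans (_ : size q' < _); last by rewrite -[size q']/((size (x :: q')).-1) prednK // -(card_uniqP uq') max_card.
by rewrite ltnS; apply: kmin; apply/existsP; exists (in_tuple q'); rewrite eq' /= -lq'.
Qed.
End Components.

(** * The graph defined by a dynamic stream *)

Section StreamedGraph.
Variable n : nat.
Implicit Types tau : seq (upd n).

Definition edge tau (u v : 'I_n) : bool := (u < v) && (mult tau u v == 1%R).

Lemma adjE tau u v : adj tau u v = edge tau (lo u v) (hi u v).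
Proof.
rewrite /adj /lo /hi /edge; case: ltngtP => [uv|vu|E].
- by rewrite uv orbF.
- by rewrite vu.
by rewrite E ltnn.
Qed.

Lemma adj_sym tau : symmetric (adj tau).
Proof. by move=> u v; rewrite /adj orbC. Qed.

Lemma edge_adj tau u v : edge tau u v -> adj tau u v.
Proof. by rewrite /edge /adj => ->. Qed.

Local Open Scope ring_scope.

Lemma mult_cons x tau u v : mult (x :: tau) u v =
  (if x.1 == (u, v) then if x.2 then 1 else -1 else 0) + mult tau u v.
Proof. by rewrite /mult /=; case: (x.1 == _); case: x.2 => /=; lia. Qed.

(** For [u >= v] a valid stream never updates the pair, so the multiplicities form a 0/1 matrix on
    all pairs. *)
Lemma mult_edge k tau u v : valid_stream k tau -> mult tau u v = (edge tau u v : nat).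
Proof.
case/and3P=> _ /allP lt_tau /forallP/(_ u)/forallP/(_ v); rewrite /edge.
have [uv /=|vu _ /=] := boolP (u < v)%N; first by case/orP=> /eqP ->.
have no (q : pred (upd n)) : count (fun x => (x.1 == (u, v)) && q x) tau = 0%N.
  apply/eqP; rewrite -leqn0 leqNgt -has_count; apply/hasPn => x /lt_tau.
  by case: eqP => // ->; rewrite (negPf vu).
by rewrite /mult (no snd) (no (fun x => ~~ x.2)).
Qed.

(** A running signed sum depends only on the final multiplicities, which is how deletions are
    handled. *)
Lemma sum_stream_mult (K : fieldType) tau (h : 'I_n -> 'I_n -> K) :
  \sum_(x <- tau) (if x.2 then 1 else -1) * h x.1.1 x.1.2 =
  \sum_u \sum_v (mult tau u v)%:~R * h u v.
Proof.
elim: tau => [|x tau IH].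
  by rewrite big_nil big1 // => u _; rewrite big1 // => v _; rewrite mul0r.
rewrite big_cons IH; under [RHS]eq_bigr => u _.
  under eq_bigr => v _ do rewrite mult_cons intrD mulrDl.
  rewrite big_split /=; over.
rewrite big_split /=; congr (_ + _).
rewrite (bigD1 x.1.1) //= (bigD1 x.1.2) //= -surjective_pairing eqxx.
rewrite big1 => [|v neq]; last by rewrite ifF ?mul0r //; apply: contraNF neq => /eqP ->.
rewrite addr0 big1 ?addr0 => [|u neq]; first by case: x.2.
by apply: big1 => v _; rewrite ifF ?mul0r //; apply: contraNF neq => /eqP ->.
Qed.
End StreamedGraph.

(** * The protocol, its soundness and its completeness *)

Section Protocol.
Local Open Scope ring_scope.
Variables (K : finFieldType) (n : nat) (i0 : 'I_n) (m : nat).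
Hypothesis natK : forall a b : nat, (a <= n + n ^ 4)%N -> (b <= n + n ^ 4)%N ->
  a%:R = b%:R :> K -> a = b.
Hypothesis n_gt1 : (1 < n)%N.
Variable phi : m.-tuple bool -> K.
Hypothesis phi_inj : injective phi.

(* label, parent, depth, number of children, coefficient of a prover polynomial *)
Definition letter := ('I_n * 'I_n * 'I_n * 'I_n.+1 * K)%type.
Implicit Types (a : letter) (r : K * K) (tau : seq (upd n)) (w : seq letter).

Definition letter_l a := a.1.1.1.1.
Definition letter_p a := a.1.1.1.2.
Definition letter_d a := a.1.1.2.
Definition letter_ch a := a.1.2.
Definition letter_coef a := a.2.
Definition letter0 : letter := (i0, i0, i0, ord0, 0).

(** Accumulator 0 is the stream factor of [horner_sumcheck2]. Accumulators 1 and 2 hold a value and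
    the coefficient [n.-1] of the first prover polynomial, 3 and 4 those of the second, 5 the number
    of non-roots, 6 the depth polynomial, and 7 to 11 the sums of [horner_cert_weight]. *)
Definition stream_contrib r (x : upd n) : 'rV[K]_12 :=
  \row_i (if i == 0 :> nat then (if x.2 then 1 else -1) *
            (r.1 ^+ (n.-1 - x.1.1) * r.2 ^+ (n.-1 - x.1.2)) else 0).

Definition cert_contrib r (i l p d : 'I_n) (ch : nat) : seq K :=
  let nonroot : K := (l != i)%:R in
  [:: nonroot;
      nonroot * r.1 ^+ (p * n.+1 + d) - ch%:R * r.1 ^+ (i * n.+1 + d.+1);
      nonroot * (r.1 ^+ lo i p * r.2 ^+ hi i p);
      l%:R * r.1 ^+ i; l%:R * r.2 ^+ i; l%:R ^+ 2 * r.1 ^+ i; l%:R ^+ 2 * r.2 ^+ i].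

(** A message has [2 * n] words, one per polynomial coefficient. Only the first [n] words of the
    first message also carry certificate data. *)
Definition word_contrib r (j : nat) a : seq K :=
  let f := letter_coef a in
  if (j < 2 * n)%N then
    [:: 0; f * r.1 ^+ j; f * (j == n.-1)%:R; 0; 0] ++
    (if insub j is Some i
     then cert_contrib r i (letter_l a) (letter_p a) (letter_d a) (letter_ch a) else [::])
  else [:: 0; 0; 0; f * r.2 ^+ (j - 2 * n); f * (j - 2 * n == n.-1)%N%:R].

Definition word_vec r j a : 'rV[K]_12 := \row_i (word_contrib r j a)`_i.

(** [W] is the weight polynomial at the two secret points. The tests are, in order: claimed sum,
    depths, link between the rounds, final evaluation. The answer is [n] minus the number of
    non-roots, read back from [K]. *)
Definition decide r (z : 'rV[K]_12) : option nat :=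
  let c i := z 0 (@inord 11 i) in
  let I (x : K) := \sum_(i < n) x ^+ i in
  let W := c 7%N - (c 10%N * I r.2 + I r.1 * c 11%N - 2 * (c 8%N * c 9%N)) in
  if [&& c 2 == c 5%N, c 6%N == 0, c 4%N == c 1 & c 3%N == W * c 0]
  then omap (@nat_of_ord n.+1) [pick j : 'I_n.+1 | (j : nat)%:R + c 5%N == n%:R]
  else None.

Definition summary r tau w0 w1 : 'rV[K]_12 :=
  \sum_(x <- tau) stream_contrib r x
  + (\sum_(j < 2 * n) word_vec r j (nth letter0 w0 j)
     + \sum_(j < 2 * n) word_vec r (2 * n + j) (nth letter0 w1 j)).

Section Summary.
Variables (r : K * K) (k : nat) (tau : seq (upd n)) (w0 w1 : seq letter).
Hypothesis valid_tau : valid_stream k tau.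

Variables (l p d : 'I_n -> 'I_n) (ch : 'I_n -> nat).
Hypotheses (lE : forall i : 'I_n, letter_l (nth letter0 w0 i) = l i)
           (pE : forall i : 'I_n, letter_p (nth letter0 w0 i) = p i)
           (dE : forall i : 'I_n, letter_d (nth letter0 w0 i) = d i)
           (chE : forall i : 'I_n, letter_ch (nth letter0 w0 i) = ch i :> nat).
Definition word_poly w : {poly K} := \poly_(j < 2 * n) letter_coef (nth letter0 w j).
Definition edgeK (u v : 'I_n) : K := (edge tau u v : nat)%:R.

Lemma summaryE i : (i < 12)%N -> summary r tau w0 w1 0 (@inord 11 i) =
  (if i == 0%N then \sum_(x <- tau) (if x.2 then 1 else -1) *
            (r.1 ^+ (n.-1 - x.1.1) * r.2 ^+ (n.-1 - x.1.2)) else 0)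
  + (\sum_(j < 2 * n) (word_contrib r j (nth letter0 w0 j))`_i
     + \sum_(j < 2 * n) (word_contrib r (2 * n + j) (nth letter0 w1 j))`_i).
Proof.
move=> i12; rewrite /summary !mxE !summxE; congr (_ + (_ + _)); first last.
- by apply: eq_bigr => j _; rewrite mxE inordK.
- by apply: eq_bigr => j _; rewrite mxE inordK.
case: eqP => iE; last by rewrite big1 // => x _; rewrite mxE inordK //; case: eqP.
by apply: eq_bigr => x _; rewrite mxE inordK // iE.
Qed.

Lemma sum_contrib1 i : (i < 3)%N \/ (4 < i)%N ->
  \sum_(j < 2 * n) (word_contrib r (2 * n + j) (nth letter0 w1 j))`_i = 0.
Proof.
move=> i3; apply: big1 => j _; rewrite /word_contrib ltnNge leq_addr /=.
by case: i i3 => [|[|[|[|[|i]]]]] [] //= _; rewrite nth_nil.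
Qed.

Lemma sum_contrib0 i : (4 < i)%N ->
  \sum_(j < 2 * n) (word_contrib r j (nth letter0 w0 j))`_i =
  \sum_(j < n) (cert_contrib r j (l j) (p j) (d j) (ch j))`_(i - 5).
Proof.
move=> i4; rewrite -(big_mkord xpredT (fun j => (word_contrib r j (nth letter0 w0 j))`_i)).
rewrite (@big_cat_nat _ _ _ n) //= ?leq_pmull // [X in _ + X]big_nat [X in _ + X]big1 ?addr0.
  rewrite big_mkord; apply: eq_bigr => j _; rewrite /word_contrib valK lE pE dE chE.
  rewrite ifT; last by have := ltn_ord j; lia.
  by rewrite nth_cat /= ltnNge i4.
move=> j /andP[nj j2]; rewrite /word_contrib j2 insubF ?cats0; last by lia.
by rewrite nth_default.
Qed.

Lemma sum_coef_eq w : \sum_(j < 2 * n) letter_coef (nth letter0 w j) * (j == n.-1 :> nat)%:R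
  = (word_poly w)`_n.-1.
Proof.
have n1 : (n.-1 < 2 * n)%N by lia.
rewrite coef_poly n1 (bigD1 (Ordinal n1)) //= eqxx mulr1 big1 ?addr0 // => j.
by rewrite -val_eqE /= => /negPf ->; rewrite mulr0.
Qed.

Lemma horner_word_poly w x :
  \sum_(j < 2 * n) letter_coef (nth letter0 w j) * x ^+ j = (word_poly w).[x].
Proof. by rewrite horner_poly. Qed.

Definition accepting : bool :=
  [&& (word_poly w0)`_n.-1 == #|[pred i | l i != i]|%:R,
      (depth_poly K l p d ch).[r.1] == 0,
      (word_poly w1)`_n.-1 == (word_poly w0).[r.1] &
      (word_poly w1).[r.2] == (sumcheck2 edgeK (cert_weight K l p) r.1).[r.2]].

Lemma decideE : decide r (summary r tau w0 w1) =
  if accepting then Some #|[pred i | l i == i]| else None.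
Proof.
have c0 : summary r tau w0 w1 0 (@inord 11 0) =
    \sum_u \sum_v edgeK u v * r.1 ^+ (n.-1 - u) * r.2 ^+ (n.-1 - v).
  rewrite summaryE //= sum_contrib1 ?addr0; last by left.
  rewrite [X in _ + X]big1 ?addr0 => [|j _]; last by rewrite /word_contrib ltn_ord.
  rewrite (sum_stream_mult _ (fun u v => r.1 ^+ (n.-1 - u) * r.2 ^+ (n.-1 - v))).
  apply: eq_bigr => u _; apply: eq_bigr => v _.
  by rewrite (mult_edge _ _ valid_tau) mulrA.
have c1 : summary r tau w0 w1 0 (@inord 11 1) = (word_poly w0).[r.1].
  rewrite summaryE //= add0r sum_contrib1 ?addr0 -?horner_word_poly; last by left.
  by apply: eq_bigr => j _; rewrite /word_contrib ltn_ord.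
have c2 : summary r tau w0 w1 0 (@inord 11 2) = (word_poly w0)`_n.-1.
  rewrite summaryE //= add0r sum_contrib1 ?addr0 -?sum_coef_eq; last by left.
  by apply: eq_bigr => j _; rewrite /word_contrib ltn_ord.
have c3 : summary r tau w0 w1 0 (@inord 11 3) = (word_poly w1).[r.2].
  rewrite summaryE //= add0r big1 ?add0r -?horner_word_poly => [|j _].
    by apply: eq_bigr => j _; rewrite /word_contrib ltnNge leq_addr addKn.
  by rewrite /word_contrib ltn_ord.
have c4 : summary r tau w0 w1 0 (@inord 11 4) = (word_poly w1)`_n.-1.
  rewrite summaryE //= add0r big1 ?add0r -?sum_coef_eq => [|j _].
    by apply: eq_bigr => j _; rewrite /word_contrib ltnNge leq_addr addKn.
  by rewrite /word_contrib ltn_ord.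
have cE i : (4 < i)%N -> (i < 12)%N -> summary r tau w0 w1 0 (@inord 11 i) =
    \sum_(j < n) (cert_contrib r j (l j) (p j) (d j) (ch j))`_(i - 5).
  move=> i4 i12; rewrite summaryE // sum_contrib1; last by right.
  by rewrite sum_contrib0 // addr0 ifF ?add0r //; lia.
have c5 : summary r tau w0 w1 0 (@inord 11 5) = #|[pred i | l i != i]|%:R.
  rewrite cE //= -sum1_card natr_sum [RHS]big_mkcond /=; apply: eq_bigr => j _.
  by rewrite inE; case: (_ != _).
have c6 : summary r tau w0 w1 0 (@inord 11 6) = (depth_poly K l p d ch).[r.1].
  rewrite cE //= sumrB hornerD hornerN !horner_sum; congr (_ - _).
    rewrite [RHS]big_mkcond; apply: eq_bigr => j _; rewrite hornerXn.
    by case: (_ != _); rewrite ?mul1r ?mul0r.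
  by apply: eq_bigr => j _; rewrite hornerZ hornerXn.
rewrite /decide /accepting horner_sumcheck2 horner_cert_weight c1 c2 c3 c4 c5 c6 c0 !cE //=.
case: ifP => // _.
have cardE : (#|[pred i | l i == i]| + #|[pred i | l i != i]| = n)%N.
  by rewrite -[RHS](card_ord n) -(cardC [pred i | l i == i]).
have n4 : (n <= n ^ 4)%N by rewrite -{1}(expn1 n) leq_pexp2l //; lia.
(* Both sides of the picked equation are at most [2 * n <= n + n ^ 4], so [natK] makes it hold over
   the naturals. *)
case: pickP => [j /eqP|/(_ (inord #|[pred i | l i == i]|))] /=.
  rewrite -natrD => /natK E; congr Some; have := ltn_ord j.
  by have := E ltac:(have := ltn_ord j; lia) ltac:(lia); lia.
by rewrite inordK -?natrD ?cardE ?eqxx //; lia.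
Qed.
End Summary.

Lemma sound_num_cc k tau (l p d : 'I_n -> 'I_n) (ch : 'I_n -> nat) :
    valid_stream k tau -> depth_poly K l p d ch = 0 ->
    \sum_u \sum_v cert_weight K l p u v * edgeK tau u v = #|[pred i | l i != i]|%:R ->
  num_cc tau = #|[pred i | l i == i]|.
Proof.
move=> valid_tau depth0 /(cert_weight_sound natK)[forest cross].
apply: (@n_comp_certificate _ _ (@adj_sym n tau) l p d) => [u v|i li|i li].
- rewrite adjE /lo /hi; case: ifP => _ /cross -> //.
- by rewrite adjE forest.
exact: (depth_poly_eq0 natK depth0 li).
Qed.

Variables (S' b bK : nat).
Hypothesis b_gt0 : (0 < b)%N.
Variables (encL : letter -> b.-tuple bool) (decL : b.-tuple bool -> letter).
Variables (encK : K -> bK.-tuple bool) (decK : bK.-tuple bool -> K).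
Hypotheses (encLK : cancel encL decL) (encKK : cancel encK decK).

Definition of_bits q (s : seq bool) : q.-tuple bool := insubd [tuple of nseq q false] s.

Lemma of_bitsK q : cancel val (@of_bits q).
Proof. by move=> t; apply: valKd. Qed.

Notation S := (m + (m + S'))%N.
(** Two disjoint blocks of [m] bits give independent points; the other [S'] bits only make room for
    the state. *)
Definition seed (rho : S.-tuple bool) : K * K :=
  (phi (of_bits m (take m rho)), phi (of_bits m (take m (drop m rho)))).

Lemma avg_seed (g : K * K -> rat) :
  avg (fun rho => g (seed rho)) = avg (fun x => avg (fun y => g (phi x, phi y))).
Proof.
rewrite avg_cat; apply: eq_avg => x; rewrite avg_cat; apply: eq_avg => y.
rewrite -[RHS](avg_const S'); apply: eq_avg => z.
by rewrite /seed /= drop_size_cat ?take_size_cat ?size_tuple // !of_bitsK.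
Qed.

Definition read_letter (s : seq bool) : letter := decL (of_bits b s).
Definition challenge r : seq bool := encK r.1.

Variables (enc : lv_state (K * K)%type 'rV[K]_12 b (2 * n) -> S.-tuple bool)
          (dec : S.-tuple bool -> lv_state (K * K)%type 'rV[K]_12 b (2 * n)).
Hypothesis encSK : cancel enc dec.

Definition cc_verifier : verifier (upd n) S :=
  linear_verifier read_letter stream_contrib word_vec challenge decide seed enc dec.

(** The first message is fixed before the points are drawn, so whether the certificate has the right
    number of roots ([good]) is not random. If it has, any output is allowed; otherwise a case split
    bounds the acceptance probability by 1/3. *)
Lemma cc_sound k (P : prover (upd n)) tau :
    valid_stream k tau -> (12 * n <= 2 ^ m)%N -> (3 * (n * n.+1) <= 2 ^ m)%N ->
  2%:R / 3%:R <= prob_out cc_verifier P tau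
    (fun o => (o == Some (num_cc tau)) || (o == None)).
Proof.
move=> valid_tau lin_m quad_m.
rewrite (prob_linear_verifier b_gt0 _ _ _ _ _ _ encSK letter0).
pose w0 := lv_words b (2 * n) read_letter (P tau [:: [::]]).
(* The second answer depends on the first point only; the second point stays secret. *)
pose w1 x := lv_words b (2 * n) read_letter (P tau [:: [::]; P tau [:: [::]]; val (encK x)]).
pose l (i : 'I_n) := letter_l (nth letter0 w0 i).
pose p (i : 'I_n) := letter_p (nth letter0 w0 i).
pose d (i : 'I_n) := letter_d (nth letter0 w0 i).
pose ch (i : 'I_n) : nat := letter_ch (nth letter0 w0 i).
have m_gt0 : 0 < ((2 ^ m)%N)%:R :> rat by rewrite ltr0n expn_gt0.
have small (q : nat) : (3 * q <= 2 ^ m)%N -> q%:R / ((2 ^ m)%N)%:R <= 1 / 3%:R :> rat.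
  by move=> qm; rewrite ler_pdivrMr // mulrC mulrA mulr1 ler_pdivlMr // mulrC -natrM ler_nat.
pose good := num_cc tau == #|[pred i | l i == i]|.
suff bad_le : ~~ good ->
    avg (fun x => avg (fun y => (accepting (phi x, phi y) tau w0 (w1 (phi x)) l p d ch : nat)%:R))
      <= 1 / 3%:R :> rat.
  pose bad r : nat := ~~ good && accepting r tau w0 (w1 r.1) l p d ch.
  apply: le_trans (_ : avg (fun rho => 1 - (bad (seed rho))%:R) <= _).
    rewrite avgBl (avg_seed (fun r => (bad r)%:R)) /bad.
    have [_|/bad_le] /= := boolP good; last by lra.
    under eq_avg do rewrite avg_const.
    by rewrite avg_const; lra.
  apply: ler_avg => rho; rewrite /lv_answer; case: ifP => _; last first.
    by rewrite orbT gerBl.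
  rewrite -/(summary _ _ _ _) (@decideE _ _ _ _ _ valid_tau l p d ch) // /bad.
  case: accepting; last by rewrite orbT gerBl.
  by rewrite andbT /good; have [->|_] := eqVneq (num_cc tau) _; rewrite ?eqxx ?subrr ?ler0n ?subr0.
(* Acceptance makes a nonzero [depth_poly] vanish at the first point. *)
move=> neq; have [depth0|depth_neq0] := eqVneq (depth_poly K l p d ch) 0; last first.
  apply: le_trans (small _ quad_m).
  apply: le_trans (_ : (size (depth_poly K l p d ch))%:R / ((2 ^ m)%N)%:R <= _); last first.
    by rewrite ler_pM2r ?invr_gt0 // ler_nat size_depth_poly.
  apply: le_trans (avg_root phi_inj depth_neq0).
  apply: ler_avg => x; rewrite -[leRHS](avg_const m); apply: ler_avg => y.
  rewrite ler_nat rootE; case Acc: (accepting _ _ _ _ _ _ _ _) => //; case/and4P: Acc => _ + _ _.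
  by rewrite /= => ->.
(* If the first polynomial is honest, the test on its coefficient is the hypothesis of
   [sound_num_cc], which contradicts [neq]. *)
have [eq1|neq1] := eqVneq (word_poly w0) (sumcheck1 (edgeK tau) (cert_weight K l p)).
  under eq_avg => x.
    under eq_avg => y.
      have -> : accepting (phi x, phi y) tau w0 (w1 (phi x)) l p d ch = false.
        apply: contraNF neq => /and4P[+ _ _ _].
        rewrite eq1 coef_sumcheck1 => /eqP sumE.
        by apply/eqP/(sound_num_cc valid_tau depth0 sumE).
      over.
    rewrite avg_const; over.
  by rewrite avg_const divr_ge0.
(* Otherwise the sum-check error applies, and [12 * n <= 2 ^ m] makes it at most 1/3. *)
apply: le_trans (small (4 * n)%N _); last by rewrite mulnA.
have := avg_sumcheck phi_inj neq1 (size_poly _ _) (fun x => size_poly _ _ : (size (word_poly (w1 x)) <= _)%N).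
apply: le_trans; apply: ler_avg => x; apply: ler_avg => y; rewrite ler_nat.
by case Acc: (accepting _ _ _ _ _ _ _ _) => //; case/and4P: Acc => _ _ -> /= ->.
Qed.

(** The choice by [pick] makes the forest a function of the stream; by [bfs_forest] the default
    never occurs. *)
Definition honest_forest tau : {ffun 'I_n -> 'I_n} * {ffun 'I_n -> 'I_n} :=
  odflt ([ffun i => i], [ffun i => i])
    [pick c : {ffun 'I_n -> 'I_n} * {ffun 'I_n -> 'I_n} |
      [forall i, (fingraph.root (adj tau) i != i) ==>
                adj tau i (c.1 i) && ((c.2 (c.1 i)).+1 == c.2 i)%N]].

Lemma honest_forestP tau i : fingraph.root (adj tau) i != i ->
  adj tau i ((honest_forest tau).1 i) /\
  (((honest_forest tau).2 ((honest_forest tau).1 i)).+1 = (honest_forest tau).2 i :> nat)%N.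
Proof.
rewrite /honest_forest; case: pickP => [c /forallP/(_ i)/implyP ok /ok/andP[? /eqP]|] //.
have [p [d [d_lt p_adj p_d]]] := bfs_forest (@adj_sym n tau).
have d_ltn j : (d j < n)%N by rewrite -[ltnRHS](card_ord n).
move/(_ ([ffun j => p j], [ffun j => Ordinal (d_ltn j)]))/negP; case.
by apply/forallP => j; apply/implyP => rj; rewrite !ffunE /= p_adj //= p_d.
Qed.

Definition honest_l tau := fingraph.root (adj tau).
Definition honest_p tau i := (honest_forest tau).1 i.
Definition honest_d tau i := (honest_forest tau).2 i.
Definition honest_ch tau i :=
  #|[pred j | (honest_l tau j != j) && (honest_p tau j == i)]|.

(** For [j >= n] the certificate fields are those of [i0], which [word_contrib] ignores. *)
Definition honest_word0 tau (j : nat) : letter :=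
  let i := insubd i0 j in
  (honest_l tau i, honest_p tau i, honest_d tau i, inord (honest_ch tau i),
   (sumcheck1 (edgeK tau) (cert_weight K (honest_l tau) (honest_p tau)))`_j).

Definition honest_word1 tau x (j : nat) : letter :=
  (i0, i0, i0, ord0,
   (sumcheck2 (edgeK tau) (cert_weight K (honest_l tau) (honest_p tau)) x)`_j).

Definition write_letters w : seq bool := flatten [seq val (encL a) | a <- w].

Definition honest_prover : prover (upd n) := fun tau tr =>
  if tr is [:: _; _; c] then
    write_letters (mkseq (honest_word1 tau (decK (of_bits bK c))) (2 * n))
  else write_letters (mkseq (honest_word0 tau) (2 * n)).

Lemma shape_write_letters w :
  shape [seq val (encL a) | a <- w] = nseq (size w) b.
Proof. by elim: w => //= a w ->; rewrite size_tuple. Qed.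

Lemma size_write_letters w : size (write_letters w) = (size w * b)%N.
Proof. by rewrite size_flatten shape_write_letters sumn_nseq mulnC. Qed.

Lemma read_write_letters w : size w = (2 * n)%N ->
  lv_words b (2 * n) read_letter (write_letters w) = w.
Proof.
move=> szw; rewrite /lv_words -szw -shape_write_letters flattenK -map_comp.
by rewrite map_id_in // => a _; rewrite /= /read_letter of_bitsK encLK.
Qed.

Lemma honest_answer k tau r : valid_stream k tau ->
  lv_answer b (2 * n) read_letter stream_contrib word_vec challenge decide
    letter0 honest_prover tau r = Some (num_cc tau).
Proof.
move=> valid_tau; rewrite /lv_answer /lv_msg1 /lv_msg0 /= /challenge of_bitsK encKK.
rewrite !size_write_letters !size_mkseq eqxx /= !read_write_letters ?size_mkseq //.
rewrite -/(summary _ _ _ _).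
set w0 := mkseq _ _; set w1 := mkseq _ _.
have n2 (i : 'I_n) : (i < 2 * n)%N by have := ltn_ord i; lia.
have w0E (i : 'I_n) : nth letter0 w0 i = honest_word0 tau i by rewrite nth_mkseq.
rewrite (@decideE _ _ _ _ _ valid_tau (honest_l tau) (honest_p tau) (honest_d tau)
  (honest_ch tau)); try by move=> i; rewrite w0E /honest_word0 valKd.
  rewrite ifT.
    congr Some; apply: eq_card => i; by rewrite !inE andbT.
  (* The honest polynomials have size at most [2 * n], so truncation loses nothing. *)
  have poly0 : word_poly w0 = sumcheck1 (edgeK tau) (cert_weight K (honest_l tau) (honest_p tau)).
    apply/polyP => j; rewrite coef_poly; case: ltnP => j2; first by rewrite nth_mkseq.
    by rewrite nth_default // (leq_trans (size_sumcheck1 _ _)).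
  have poly1 : word_poly w1 =
      sumcheck2 (edgeK tau) (cert_weight K (honest_l tau) (honest_p tau)) r.1.
    apply/polyP => j; rewrite coef_poly; case: ltnP => j2; first by rewrite nth_mkseq.
    by rewrite nth_default // (leq_trans (size_dot_poly _ _)).
  rewrite /accepting poly0 poly1 coef_sumcheck1 coef_sumcheck2 !eqxx !andbT.
  rewrite cert_weight_correct; first last.
  - move=> u v /edge_adj uv; exact/(fingraph.rootP (sym_connect_sym (@adj_sym n tau)))/connect1.
  - by move=> i /honest_forestP[]; rewrite adjE.
  rewrite eqxx depth_poly_correct ?horner0 ?eqxx //.
  by move=> i /honest_forestP[].
move=> i; rewrite w0E /honest_word0 valKd /= inordK // ltnS.
by rewrite -[leqRHS](card_ord n) max_card.
Qed.

(** The honest prover succeeds on every seed. The cost is two messages of [2 * n] words of [b] bits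
    and one challenge of [bK] bits. *)
Lemma cc_complete k tau : valid_stream k tau ->
  2%:R / 3%:R <= prob_out cc_verifier honest_prover tau (fun o => o == Some (num_cc tau)) /\
  always cc_verifier honest_prover tau
    (fun _ tr => sumn (map size tr) <= 4 * n * b + bK)%N.
Proof.
move=> valid_tau; split.
  rewrite (prob_linear_verifier b_gt0 _ _ _ _ _ _ encSK letter0).
  under eq_avg => rho do rewrite (honest_answer _ valid_tau) eqxx.
  by rewrite avg_const /= mulr1n; lra.
apply: (always_linear_verifier _ _ _ _ _ encSK) => _ r.
rewrite /lv_transcript /lv_msg1 /lv_msg0 /= !size_write_letters !size_mkseq size_tuple.
by rewrite addn0 !add0n; lia.
Qed.

Lemma cc_verifier_SIP k : (12 * n <= 2 ^ m)%N -> (3 * (n * n.+1) <= 2 ^ m)%N ->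
  is_SIP cc_verifier (@valid_stream n k) (@num_cc n) (4 * n * b + bK)%N 2.
Proof.
move=> lin_m quad_m; split=> //; split.
  by exists honest_prover => tau; apply: cc_complete.
by move=> P tau valid_tau; apply: (cc_sound P valid_tau).
Qed.
End Protocol.

(** * Choice of the field and of the parameters *)

Lemma Fp_natr_inj p a b : prime p -> a < p -> b < p ->
  a%:R%R = b%:R%R :> 'F_p -> a = b.
Proof.
move=> pr_p ap bp /(congr1 (@nat_of_ord _)).
by rewrite /= !val_Fp_nat // !modn_small.
Qed.

Theorem theorem8 :
  forall k : nat, exists c N0 : nat, forall n : nat, N0 <= n ->
    exists (S C : nat) (V : verifier (upd n) S),
      [/\ S <= c * (trunc_log 2 n) ^ 2,
          C <= c * (n * trunc_log 2 n) &
          is_SIP V (@valid_stream n k) (@num_cc n) C (c * trunc_log 2 n)].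
Proof.
move=> k; exists 300, 4 => n n_ge4; set L := trunc_log 2 n.
have L_ge2 : 2 <= L by apply: trunc_log_max.
have n_lt : n < 2 ^ L.+1 by apply: trunc_log_ltn.
(* [2 ^ m] exceeds all required polynomial bounds in [n], a field element takes [bK = 2 * m + 1]
   bits, and a letter takes four blocks of [L.+1] bits plus a field element. *)
pose m := 8 * L; pose bK := 16 * L + 1; pose b := 20 * L + 5.
have exp2_le e : e <= m -> 2 ^ e <= 2 ^ m by move=> em; rewrite leq_exp2l.
have lin_m : 12 * n <= 2 ^ m.
  apply: leq_trans (_ : 2 ^ 4 * 2 ^ L.+1 <= _); first by rewrite leq_mul // ltnW.
  by rewrite -expnD exp2_le // /m; lia.
have quad_m : 3 * (n * n.+1) <= 2 ^ m.
  apply: leq_trans (_ : 2 ^ 2 * (2 ^ L.+1 * 2 ^ L.+1) <= _).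
    by rewrite !leq_mul // ltnW.
  by rewrite -!expnD exp2_le // /m; lia.
have quart_m : n + n ^ 4 <= 2 ^ m.
  apply: leq_trans (_ : 2 ^ 1 * (2 ^ L.+1) ^ 4 <= _).
    rewrite expn1 mul2n -addnn leq_add //; last by rewrite leq_exp2r // ltnW.
    apply: leq_trans (_ : (2 ^ L.+1) ^ 1 <= _); first by rewrite expn1 ltnW.
    by rewrite leq_pexp2l // expn_gt0.
  by rewrite -expnM -expnD exp2_le // /m; lia.
have [p [pr_p m_lt_p p_le]] : exists p, [/\ prime p, 2 ^ m < p & p <= 2 ^ bK].
  have [|p [pr_p mp pm]] := @prime_between_exp2 m; first by rewrite /m; lia.
  by exists p; split=> //; rewrite /bK addn1 (_ : 16 * L = 2 * m) // /m; lia.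
have natK a c : a <= n + n ^ 4 -> c <= n + n ^ 4 -> a%:R%R = c%:R%R :> 'F_p -> a = c.
  by move=> an cn; apply: Fp_natr_inj => //; apply: leq_ltn_trans m_lt_p; lia.
have card_bits : #|{: m.-tuple bool}| = 2 ^ m by rewrite card_tuple card_bool.
(* Bit strings become the residues below [2 ^ m < p], which are distinct. *)
pose phi (t : m.-tuple bool) : 'F_p := ((enum_rank t : nat)%:R)%R.
have phi_inj : injective phi.
  move=> x y /Fp_natr_inj E; apply/enum_rank_inj/val_inj/E => //;
    by apply: leq_trans m_lt_p; rewrite ltnS -card_bits ltnW.
have i0 : 'I_n by exists 0; lia.
have cardK : #|{: 'F_p}| = p by rewrite card_Fp.
have [encK [decK encKK]] : exists (e : 'F_p -> bK.-tuple bool) d, cancel e d.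
  by apply: bit_coding; [exact: 0%R | rewrite cardK].
have [encL [decL encLK]] : exists (e : letter 'F_p n -> b.-tuple bool) d, cancel e d.
  apply: bit_coding; first exact: letter0 i0.
  rewrite !card_prod cardK !card_ord.
  apply: leq_trans (_ : 2 ^ L.+1 * 2 ^ L.+1 * 2 ^ L.+1 * 2 ^ L.+1 * 2 ^ bK <= _).
    by rewrite !leq_mul // ltnW.
  by rewrite -!expnD leq_exp2l // /b /bK; lia.
(* The state has 14 field elements, a counter of [L + 3 + b] bits and a register of [b] bits:
   [265 * L + 27] bits, of which [2 * m] precede the padding. *)
pose S' := 249 * L + 27.
have [enc [dec encSK]] : exists
    (e : lv_state ('F_p * 'F_p)%type 'rV['F_p]_12 b (2 * n) -> (m + (m + S')).-tuple bool) d,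
    cancel e d.
  apply: bit_coding; first exact: lv_init _ _ _ (0, 0)%R.
  rewrite !card_prod card_mx cardK card_ord card_tuple card_bool mul1n.
  apply: leq_trans (_ : 2 ^ bK * 2 ^ bK * (2 ^ bK) ^ 12 * (2 ^ 2 * 2 ^ L.+1 * 2 ^ b) * 2 ^ b <= _).
    apply: leq_mul => //; apply: leq_mul.
      by apply: leq_mul; [apply: leq_mul | rewrite leq_exp2r].
    apply: leq_trans (_ : 4 * n * b.+1 <= _).
      by rewrite mulnS mulnA (_ : 2 * 2 = 4) //; lia.
    apply: leq_mul; last exact: ltn_expl.
    by apply: leq_mul => //; apply: ltnW.
  by rewrite -expnM -!expnD leq_exp2l // /b /bK /S' /m; lia.
have [_ [honest sound]] := @cc_verifier_SIP 'F_p n i0 m natK ltac:(lia) phi phi_inj S' b bK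
  ltac:(rewrite /b; lia) encL decL encK decK encLK encKK enc dec encSK k lin_m quad_m.
eexists _, _, _; split; last by split; [| split; [exact: honest | exact: sound]] => /=; lia.
  apply: leq_trans (_ : 300 * L <= _); first by rewrite /m /S'; lia.
  by rewrite leq_mul2l leq_pmulr //; lia.
have [nL Ln] : n <= n * L /\ L <= n * L by rewrite leq_pmulr ?leq_pmull //; lia.
by rewrite /b /bK; lia.
Qed.
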